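(* Let $(X,\tau,h)$ be an $h$-space, let $x_0\in X$, and let $S:X\rightrightarrows X$ be a set-valued map satisfying property $(\ast_1)$ at $x_0$. Then at least one of (a) and (b) below is true: (a) There is a divergent $S$-orbit starting at $x_0$; (b) There is an $S$-orbit starting at $x_0$ and ending at some $x\in X$ such that $S(x)=\varnothing$.
   Context: $\mathbb{R}^+=[0,\infty)$. An $h$-space is a triple $(X,\tau,h)$ where $(X,\tau)$ is a first countable Hausdorff topological space and $h:X\times X\to\mathbb{R}^+$ satisfies: (i) $h(x,y)=0\Leftrightarrow x=y$; (ii) if $h(x,x_n)\to 0$ as $n\to\infty$, then $x_n\to x$; (iii) if $x_n\to x$ as $n\to\infty$, then $h(x_{n+1},x_n)\to 0$. A set-valued map $S:X\rightrightarrows X$ assigns to each $x\in X$ a (possibly empty) subset $S(x)\subset X$. An $S$-orbit starting at $x_0$ is a finite ($x_0,\dots,x_n$, $n\ge 0$) or infinite ($x_0,x_1,\dots$) succession of points with $x_{i+1}\in S(x_i)$ for all relevant $i$. An $S$-orbit ends at $x$ if it is finite with last point $x$, or it is infinite and the sequence $\{x_i\}_{i=0}^\infty$ converges to $x$. An infinite $S$-orbit which does not converge is called a divergent $S$-orbit. $S$ satisfies property $(\ast_1)$ at $x_0\in X$ if $x\notin S(x)$ for all $x\in X$, and for each infinite $S$-orbit $\{x_i\}_{i=0}^\infty$ starting at $x_0$ and converging to some $x\in X$ and each $y\in S(x)$, there is a subsequence $\{x_{i_k}\}_{k=1}^\infty$ such that $y\in S(x_{i_k})$ for all $k\in\mathbb{N}$.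 *)

(* Defs.v *)
From mathcomp Require Import all_boot all_order all_algebra.
From mathcomp Require Import all_classical all_reals all_analysis.
Import numFieldNormedType.Exports.

Set Implicit Arguments.
Unset Strict Implicit.
Unset Printing Implicit Defensive.

Import Order.TTheory GRing.Theory Num.Theory.
Local Open Scope classical_set_scope.
Local Open Scope ring_scope.

Definition first_countable (X : topologicalType) : Prop :=
  forall x : X, exists B : set (set X),
    [/\ countable B, B `<=` nbhs x &
        forall U, nbhs x U -> exists2 V, B V & V `<=` U].

Record is_h_space (R : realType) (X : topologicalType) (h : X -> X -> R) :
    Prop := IsHSpace {
  h_space_first_countable : first_countable X ;
  h_space_hausdorff : hausdorff_space X ;
  h_space_ge0 : forall x y, 0 <= h x y ;
  h_space_eq0 : forall x y, h x y = 0 <-> x = y ;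
  h_space_cvg : forall (x : X) (u : nat -> X),
    h x (u n) @[n --> \oo] --> (0 : R) -> u @ \oo --> x ;
  h_space_step : forall (x : X) (u : nat -> X),
    u @ \oo --> x -> h (u n.+1) (u n) @[n --> \oo] --> (0 : R)
}.

(* [FinSuccession u] with [u : 'I_n.+1 -> X] is the succession u_0, ..., u_n, which
   has n + 1 points. *)
Inductive succession (X : Type) : Type :=
| FinSuccession (n : nat) of 'I_n.+1 -> X
| InfSuccession of nat -> X.

Definition is_orbit (X : Type) (S : X -> set X) (s : succession X) : Prop :=
  match s with
  | FinSuccession n u =>
      forall i j : 'I_n.+1, j = i.+1 :> nat -> S (u i) (u j)
  | InfSuccession u => forall i : nat, S (u i) (u i.+1)
  end.

Definition starts_at (X : Type) (s : succession X) (x0 : X) : Prop :=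
  match s with
  | FinSuccession n u => u ord0 = x0
  | InfSuccession u => u 0%N = x0
  end.

Definition ends_at (X : topologicalType) (s : succession X) (x : X) : Prop :=
  match s with
  | FinSuccession n u => u ord_max = x
  | InfSuccession u => u @ \oo --> x
  end.

Definition is_divergent_orbit (X : topologicalType) (S : X -> set X)
    (s : succession X) : Prop :=
  match s with
  | FinSuccession n u => False
  | InfSuccession u => is_orbit S s /\ ~ (exists x : X, u @ \oo --> x)
  end.

Definition star1 (X : topologicalType) (S : X -> set X) (x0 : X) : Prop :=
  (forall x, ~ S x x) /\
  (forall (u : nat -> X) (x : X),
     is_orbit S (InfSuccession u) -> starts_at (InfSuccession u) x0 -> u @ \oo --> x ->
     forall y, S x y ->
     exists2 phi : nat -> nat, increasing_seq phi &
       forall k : nat, S (u (phi k)) y).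

(* Main.v *)
(** Along an orbit, always choose the next point [x_{n+1}] in [S x_n] so that
    [h x_{n+1} x_n] is at least half of the supremum of [min (h y x_n) 1] over
    [y] in [S x_n].  If this greedy orbit never reaches a point with empty image
    and converges to [x], then [h x_{n+1} x_n] tends to [0], hence so does the
    supremum.  A point [y] of [S x] lies in infinitely many of the [S x_n], so
    [h y x_n] tends to [0] along a subsequence; this subsequence then converges
    to both [x] and [y], and [y = x] contradicts [x] not in [S x]. *)
Require Import Defs.
From mathcomp Require Import all_boot all_order all_algebra.
From mathcomp Require Import all_classical all_reals all_analysis.
Local Open Scope classical_set_scope.
Set Implicit Arguments.
Unset Strict Implicit.
Unset Printing Implicit Defensive.
Import Order.TTheory GRing.Theory Num.Theory numFieldNormedType.Exports.
Local Open Scope ring_scope.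

(** Truncating at 1 makes the supremum finite even when [f] is unbounded on [A]; positivity of [f]
    puts half of it strictly below it, so some value exceeds that half. *)
Lemma half_sup_attained (R : realType) (T : Type) (A : set T) (f : T -> R) :
  A !=set0 -> (forall y, A y -> 0 < f y) ->
  exists2 z, A z & forall y, A y -> Num.min (f y) 1 <= 2 * f z.
Proof.
move=> [a Aa] f0; pose E := [set Num.min (f y) 1 | y in A].
have ubE : ubound E 1 by move=> _ [y _ <-]; rewrite ge_min lexx orbT.
have hsE : has_sup E by split; [exists (Num.min (f a) 1), a | exists 1].
have leE y : A y -> Num.min (f y) 1 <= sup E.
  by move=> Ay; apply: ub_le_sup; [exists 1 | exists y].
have sup0 : 0 < sup E.
  by apply: lt_le_trans (leE a Aa); rewrite lt_min f0 //= ltr01.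
have sup2 : 0 < sup E / 2 by rewrite divr_gt0.
have [_ [z Az <-] ltz] := sup_adherent sup2 hsE.
exists z => // y Ay; apply: le_trans (leE y Ay) _.
rewrite mulrC -ler_pdivrMr //; apply/ltW.
have := lt_le_trans ltz (_ : _ <= f z).
rewrite {1}[sup E]splitr addrK; apply.
by rewrite ge_min lexx.
Qed.

Lemma increasing_seq_cvgoo (phi : nat -> nat) :
  increasing_seq phi -> phi @ \oo --> \oo.
Proof.
move=> phi_incr.
have le_phi n : (n <= phi n)%N.
  elim: n => // n IHn; apply: leq_ltn_trans IHn _.
  exact: ((increasing_seqP phi).2 phi_incr n).
move=> A [N _ NA]; exists N => // n /= Nn.
by apply: NA => /=; apply: leq_trans (le_phi n).
Qed.

Lemma cvg_min1_0 (R : realType) (a : nat -> R) :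
  Num.min (a n) 1 @[n --> \oo] --> (0 : R) -> (forall n, 0 <= a n) ->
  a @ \oo --> (0 : R).
Proof.
move=> /cvgr0Pnorm_lt min0 a0; apply/cvgr0Pnorm_lt => e e0.
(* Once [Num.min (a n) 1] is below 1, it equals [a n]. *)
have d0 : 0 < Num.min e 1 by rewrite lt_min e0 ltr01.
near=> n.
have : `|Num.min (a n) 1| < Num.min e 1 by near: n; exact: min0.
rewrite !ger0_norm ?le_min ?a0 ?ler01 // lt_min => /andP[].
by rewrite !gt_min ltxx orbF => /orP[//|lt1e] an1; exact: lt_trans lt1e.
Unshelve. all: by end_near. Qed.

Definition greedy (R : realType) (X : Type) (h : X -> X -> R)
    (S : X -> set X) (x z : X) : Prop :=
  S x z /\ forall y, S x y -> Num.min (h y x) 1 <= 2 * h z x.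

Lemma greedy_limit_empty (R : realType) (X : topologicalType)
    (h : X -> X -> R) (hX : is_h_space h) (x0 : X) (S : X -> set X)
    (hS : star1 S x0) (u : nat -> X) (x : X) :
  u 0%N = x0 -> (forall n, greedy h S (u n) (u n.+1)) -> u @ \oo --> x ->
  S x = set0.
Proof.
move=> u0 gu ux; apply/seteqP; split=> // y Sxy.
have [phi /increasing_seq_cvgoo phioo Sphi] :=
  hS.2 u x (fun i => (gu i).1) u0 ux y Sxy.
have uphix : (u \o phi) @ \oo --> x by apply: cvg_comp ux.
have step0 : 2 * h (u (phi k).+1) (u (phi k)) @[k --> \oo] --> (0 : R).
  rewrite -(mulr0 2); apply: cvgMl_tmp => //.
  (* The pairs are consecutive in [u], not in [u \o phi], so axiom (iii) is applied to [u] and then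
     restricted to the indices [phi k]. *)
  exact: (cvg_comp _ _ phioo (h_space_step hX ux)).
have min0 : Num.min (h y (u (phi k))) 1 @[k --> \oo] --> (0 : R).
  apply: squeeze_cvgr (cvg_cst 0) step0; near=> k.
  rewrite le_min (h_space_ge0 hX) ler01 /=.
  (* By [Sphi], [y] competes in the greedy choice at [u (phi k)]. *)
  exact: (gu _).2.
have uphiy : (u \o phi) @ \oo --> y.
  apply: (h_space_cvg hX); apply: cvg_min1_0 min0 _ => k.
  exact: (h_space_ge0 hX).
have xy := cvg_unique (h_space_hausdorff hX) uphix uphiy.
by case: (hS.1 x); rewrite {2}xy.
Unshelve. all: by end_near. Qed.

Theorem theorem2p3 (R : realType) (X : topologicalType) (h : X -> X -> R)
    (hX : is_h_space h) (x0 : X) (S : X -> set X) (hS : star1 S x0) :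
  (exists s : succession X, is_divergent_orbit S s /\ starts_at s x0) \/
  (exists (s : succession X) (x : X),
     [/\ is_orbit S s, starts_at s x0, ends_at s x & S x = set0]).
Proof.
have /choice[g gP] : forall x, exists z, S x !=set0 -> greedy h S x z.
  (* Where [S x] is empty, [x] is a dummy value that makes [g] total. *)
  move=> x; have [Sx0|] := pselect (S x !=set0); last by exists x.
  have [|z Sz zP] := half_sup_attained (f := h ^~ x) Sx0.
    (* Positivity comes from [x] not lying in [S x]. *)
    move=> y Sxy; rewrite lt_neqAle (h_space_ge0 hX) andbT eq_sym.
    apply/eqP => /(h_space_eq0 hX) yx; apply: (hS.1 x).
    by rewrite yx in Sxy *.
  by exists z.
pose u n := iter n g x0.
have [[n Sn0]|nonempty] := pselect (exists n, S (u n) = set0).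
  have exn : exists n, `[< S (u n) = set0 >] by exists n; apply/asboolP.
  (* Stopping at the first empty image ensures that no dummy value of [g] enters the orbit. *)
  case: (ex_minnP exn) => m /asboolP Sm0 min_m.
  right; exists (FinSuccession (fun i : 'I_m.+1 => u i)), (u m).
  split=> // i j ji; rewrite ji; apply: (gP _ _).1; apply/set0P/eqP => Si0.
  have /min_m : `[< S (u i) = set0 >] by apply/asboolP.
  by rewrite leqNgt -ltnS -ji ltn_ord.
have gu n : greedy h S (u n) (u n.+1).
  by apply: gP; apply/set0P/eqP => Sn0; apply: nonempty; exists n.
have [[x ux]|div] := pselect (exists x : X, u @ \oo --> x).
  right; exists (InfSuccession u), x; split=> //; first exact: (fun i => (gu i).1).
  exact: (greedy_limit_empty hX hS (erefl x0) gu ux).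
left; exists (InfSuccession u); split=> //; split=> //.
exact: (fun i => (gu i).1).
Qed.
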